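(* Let $\nu\ge 0$. The canonical distribution associated with the mass-penalized Hamiltonian $H_\nu(p_\nu,q)=\frac12p_\nu^TM_\nu(q)^{-1}p_\nu+V(q)+V_{\mathrm{fix},\nu}(q)$ is $$\mu_\nu(dp_\nu\,dq)=\frac1{Z_\nu}e^{-\beta H_\nu(p_\nu,q)}\,dp_\nu\,dq .$$ Its marginal probability distribution in $q$ is $$\Big(\frac1{Z_\nu}\int_{\mathbb{R}^d}e^{-\beta H_\nu(p_\nu,q)}\,dp_\nu\Big)dq=\frac{e^{-\beta V(q)}\,dq}{\int_{\mathbb{R}^d}e^{-\beta V(q)}\,dq},$$ which is the position marginal of the original canonical distribution $\frac1Ze^{-\beta(\frac12p^TM^{-1}p+V(q))}dp\,dq$ and is independent of the mass-penalization parameter $\nu$.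
   Context: $M$ ($d\times d$) and $M_z$ ($n\times n$) are symmetric positive definite matrices, $\beta>0$, $V:\mathbb{R}^d\to\mathbb{R}$ is such that $\int_{\mathbb{R}^d}e^{-\beta V}dq<\infty$, $\xi:\mathbb{R}^d\to\mathbb{R}^n$ is smooth, $(\nabla_q\xi)_{ji}=\partial\xi_i/\partial q_j$. The penalized mass matrix is $M_\nu(q)=M+\nu^2\nabla_q\xi(q)\,M_z\,\nabla_q^T\xi(q)$, and $V_{\mathrm{fix},\nu}(q)=\frac1{2\beta}\ln\det M_\nu(q)$. $Z_\nu$ is the normalization constant. *)

(* Defs.v *)
From HB Require Import structures.
From mathcomp Require Import all_boot all_order all_algebra.
From mathcomp Require Import all_classical all_reals all_analysis.

Set Implicit Arguments.
Unset Strict Implicit.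
Unset Printing Implicit Defensive.

Import Order.TTheory GRing.Theory Num.Theory.
Import numFieldNormedType.Exports.

Local Open Scope classical_set_scope.
Local Open Scope ring_scope.

(* R^n is 'cV[R]_n, with the product of the Borel sigma-algebras of the        *)
(* coordinates (the construction MathComp-Analysis uses for n.-tuple T).       *)
Section measurable_cV.
Context {R : realType} {n : nat}.

Let coords : 'I_n -> 'cV[R]_n -> measurableTypeR R := fun i v => v i 0.

Let cV_set0 : g_sigma_preimage coords set0.
Proof. exact: sigma_algebra0. Qed.

Let cV_setC A : g_sigma_preimage coords A -> g_sigma_preimage coords (~` A).
Proof. exact: sigma_algebraC. Qed.

Let cV_bigcup (F : (set 'cV[R]_n)^nat) :
    (forall i, g_sigma_preimage coords (F i)) ->
  g_sigma_preimage coords (\bigcup_i (F i)).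
Proof. exact: sigma_algebra_bigcup. Qed.

HB.instance Definition _ :=
  @isMeasurable.Build (measure_tuple_display default_measure_display)
    'cV[R]_n (g_sigma_preimage coords) cV_set0 cV_setC cV_bigcup.

End measurable_cV.

Section measurable_cV_theory.
Context {R : realType}.

Lemma measurable_coord n (i : 'I_n) :
  measurable_fun setT (fun v : 'cV[R]_n => v i 0 : measurableTypeR R).
Proof.
move=> _ Y mY; rewrite setTI; apply: sub_sigma_algebra => /=.
rewrite -bigcup_seq/=; exists i => /=; first by rewrite mem_index_enum.
by exists Y => //; rewrite setTI.
Qed.

Lemma measurable_fun_cVP d (T : measurableType d) n (f : T -> 'cV[R]_n) :
  (forall i, measurable_fun setT (fun x => f x i 0 : measurableTypeR R)) ->
  measurable_fun setT f.
Proof.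
move=> mf _ Y mY; rewrite setTI.
suff : measurable `<=` [set B | measurable (f @^-1` B)] by apply.
apply: smallest_sub.
  split => [|A mA|F mF].
  - by rewrite /= preimage_set0.
  - by rewrite /= setTD -preimage_setC; exact: measurableC.
  - by rewrite /= preimage_bigcup; exact: bigcupT_measurable.
rewrite -bigcup_seq => A [i _ /= [B mB <-]].
by rewrite setTI -[X in measurable X]setTI; exact: (mf i).
Qed.

Definition consv n (x : measurableTypeR R * 'cV[R]_n) : 'cV[R]_n.+1 :=
  col_mx (x.1 : R)%:M x.2.

Definition unconsv n (v : 'cV[R]_n.+1) : measurableTypeR R * 'cV[R]_n :=
  (v ord0 0, dsubmx (v : 'cV[R]_(1 + n))).

Lemma consvK n : cancel (@consv n) (@unconsv n).
Proof.
case=> x v; rewrite /unconsv /consv /=; congr pair; last by rewrite col_mxKd.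
have -> : ord0 = lshift n (0 : 'I_1) by apply: val_inj.
by apply: (etrans (col_mxEu _ _ _ _)); rewrite mxE eqxx.
Qed.

Lemma unconsvK n : cancel (@unconsv n) (@consv n).
Proof.
move=> v; rewrite /unconsv /consv /=.
have -> : (v ord0 0)%:M = usubmx (v : 'cV[R]_(1 + n)).
  apply/matrixP => i j; rewrite !ord1 !mxE eqxx mulr1n.
  by congr (v _ _); apply: val_inj.
exact: (vsubmxK (v : 'cV[R]_(1 + n))).
Qed.

Lemma measurable_consv n : measurable_fun setT (@consv n).
Proof.
apply: measurable_fun_cVP => i.
have [[j|j] ->] : exists s : 'I_1 + 'I_n, i = unsplit s :> 'I_(1 + n).
  by exists (fintype.split (i : 'I_(1 + n))); rewrite fintype.splitK.
- rewrite (_ : (fun _ => _) = fst) ?measurable_fst//.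
  by apply/funext => x; apply: (etrans (col_mxEu _ _ _ _)); rewrite !ord1 mxE eqxx.
- rewrite (_ : (fun _ => _) = (fun v : 'cV[R]_n => v j 0 : measurableTypeR R) \o snd).
    by apply: measurableT_comp; [exact: measurable_coord|exact: measurable_snd].
  by apply/funext => x; exact: col_mxEd.
Qed.

Lemma measurable_unconsv n : measurable_fun setT (@unconsv n).
Proof.
apply: measurable_fun_pair; first exact: measurable_coord.
apply: measurable_fun_cVP => i.
rewrite (_ : (fun _ => _) = fun v : 'cV[R]_n.+1 => v (rshift 1 i) 0 : measurableTypeR R).
  exact: measurable_coord.
by apply/funext => v; rewrite mxE.
Qed.

End measurable_cV_theory.

Section lebesgue_cons.
Context {R : realType} {n : nat} (m : {sigma_finite_measure set 'cV[R]_n -> \bar R}).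
Local Open Scope ereal_scope.

Definition lebesgue_cons : set 'cV[R]_n.+1 -> \bar R :=
  pushforward (@lebesgue_measure R \x m) (@consv R n).

Let lebesgue_cons0 : lebesgue_cons set0 = 0.
Proof. by rewrite /lebesgue_cons /pushforward preimage_set0 measure0. Qed.

Let lebesgue_cons_ge0 A : 0 <= lebesgue_cons A.
Proof. by rewrite /lebesgue_cons /pushforward; exact: measure_ge0. Qed.

Let lebesgue_cons_sigma_additive : semi_sigma_additive lebesgue_cons.
Proof. by apply: measure_semi_sigma_additive; exact: measurable_consv. Qed.

HB.instance Definition _ := isMeasure.Build _ _ _ lebesgue_cons
  lebesgue_cons0 lebesgue_cons_ge0 lebesgue_cons_sigma_additive.

Let sigma_finite_lebesgue_cons : sigma_finite setT lebesgue_cons.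
Proof.
have /sigma_finiteP[F [TF ndF Foo]] := sigma_finiteT (@lebesgue_measure R).
have /sigma_finiteP[G [TG ndG Goo]] := sigma_finiteT m.
exists (fun k => @unconsv R n @^-1` (F k `*` G k)).
  rewrite -preimage_bigcup (_ : \bigcup_k _ = setT) ?preimage_setT//.
  apply/seteqP; split => // -[x v] _.
  have [i _ Fix] : (\bigcup_i F i) x by rewrite -TF.
  have [j _ Gjv] : (\bigcup_j G j) v by rewrite -TG.
  exists (maxn i j) => //; split => /=.
  - by move: x Fix; exact/subsetPset/ndF/leq_maxl.
  - by move: v Gjv; exact/subsetPset/ndG/leq_maxr.
move=> k; have [mF Fk] := Foo k; have [mG Gk] := Goo k; split.
  rewrite -[X in measurable X]setTI.
  by apply: measurable_unconsv => //; exact: measurableX.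
rewrite /lebesgue_cons /pushforward -comp_preimage.
rewrite (_ : _ \o _ = id) ?preimage_id.
  by rewrite product_measure1E// lte_mul_pinfty// ge0_fin_numE.
by apply/funext => x /=; rewrite consvK.
Qed.

HB.instance Definition _ := Measure_isSigmaFinite.Build _ _ _ lebesgue_cons
  sigma_finite_lebesgue_cons.

End lebesgue_cons.

(* n-dimensional Lebesgue measure (on Borel sets): the unit point mass on R^0, *)
(* and the image of lebesgue_measure \x (n-dimensional measure) on R^n.+1.     *)
Fixpoint lebesgue_cV (R : realType) (n : nat) :
    {sigma_finite_measure set 'cV[R]_n -> \bar R} :=
  match n with
  | 0 => \d_(0 : 'cV[R]_0)
  | n'.+1 => lebesgue_cons (lebesgue_cV R n')
  end.

Section penalized_hamiltonian.
Context {R : realType} {d n : nat}.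

Definition symposdef k (A : 'M[R]_k) : Prop :=
  A^T = A /\ forall x : 'cV[R]_k, x != 0 -> 0 < (x^T *m A *m x) 0 0.

(* C^k: all partial derivatives of order at most k exist and are continuous. *)
Fixpoint Cclass (k : nat) (f : 'cV[R]_d -> R) : Prop :=
  continuous f /\
  match k with
  | 0 => True
  | k'.+1 => forall j : 'I_d, let e : 'cV[R]_d := delta_mx j 0 in
      (forall q, derivable f q e) /\ Cclass k' ('D_e f)
  end.

Definition smooth (xi : 'cV[R]_d -> 'cV[R]_n) : Prop :=
  forall (i : 'I_n) (k : nat), Cclass k (fun q => xi q i 0).

Implicit Types (M : 'M[R]_d) (Mz : 'M[R]_n) (xi : 'cV[R]_d -> 'cV[R]_n).
Implicit Types (V : 'cV[R]_d -> R) (beta nu : R) (p q : 'cV[R]_d).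

Definition grad xi q : 'M[R]_(d, n) :=
  \matrix_(j, i) 'D_(delta_mx j 0 : 'cV[R]_d) (fun x => xi x i 0) q.

Definition penalized_mass M Mz xi nu q : 'M[R]_d :=
  M + nu ^+ 2 *: (grad xi q *m Mz *m (grad xi q)^T).

Definition Vfix M Mz xi beta nu q : R :=
  (2 * beta)^-1 * ln (\det (penalized_mass M Mz xi nu q)).

Definition kinetic (A : 'M[R]_d) p : R :=
  2^-1 * (p^T *m invmx A *m p) 0 0.

Definition hamiltonian M V p q : R := kinetic M p + V q.

Definition penalized_hamiltonian M Mz xi V beta nu p q : R :=
  kinetic (penalized_mass M Mz xi nu q) p + V q + Vfix M Mz xi beta nu q.

End penalized_hamiltonian.

Section canonical_distribution.
Context {R : realType} {d : nat}.
Variables (beta : R) (H : 'cV[R]_d -> 'cV[R]_d -> R).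
Local Open Scope ereal_scope.

(* Lebesgue measure dp dq; phase-space points are pairs (p, q). *)
Definition phase_volume : set ('cV[R]_d * 'cV[R]_d) -> \bar R :=
  lebesgue_cV R d \x lebesgue_cV R d.

HB.instance Definition _ := Measure.on phase_volume.

Definition boltzmann (x : 'cV[R]_d * 'cV[R]_d) : \bar R :=
  (expR (- beta * H x.1 x.2))%:E.

Definition partition_function : \bar R := \int[phase_volume]_x boltzmann x.

Definition canonical_distribution (A : set ('cV[R]_d * 'cV[R]_d)) : \bar R :=
  \int[phase_volume]_(x in A) (partition_function^-1 * boltzmann x).

Definition position_marginal : set 'cV[R]_d -> \bar R :=
  pushforward canonical_distribution snd.

End canonical_distribution.

(* Main.v *)
(* For a symmetric positive definite S, completing the square in the first     *)
(* coordinate splits the quadratic form of S into S_00 times a shifted square  *)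
(* and the form of the Schur complement, while det S = S_00 * det(complement). *)
(* Tonelli and induction on the dimension thus give the Gaussian integral      *)
(* (2 pi / beta)^(d/2) / sqrt(det S) without a linear change of variables.     *)
(* With S the inverse of M_nu(q), the momentum integral is proportional to     *)
(* sqrt(det M_nu(q)), and exp(-beta V_fix,nu(q)) = 1 / sqrt(det M_nu(q))       *)
(* cancels exactly this factor.                                                *)

Require Import Defs.
From mathcomp Require Import all_boot all_order all_algebra.
From mathcomp Require Import all_classical all_reals all_analysis.
From mathcomp Require Import measurable_realfun ring.

Set Implicit Arguments.
Unset Strict Implicit.
Unset Printing Implicit Defensive.

Import Order.TTheory GRing.Theory Num.Theory.
Import numFieldNormedType.Exports.

Local Open Scope classical_set_scope.
Local Open Scope ring_scope.

(** The only fact about the Hamiltonian that matters is its momentum integral at fixed q.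
    [integral_gaussian], applied to the inverse mass matrix, turns it into K * sqrt(det M_nu(q)) *
    exp(-beta (V + V_fix,nu)), and by [expR_Vfix] this is K * exp(-beta V(q)), with K depending on
    beta and d but on neither q nor nu. For the original Hamiltonian the integral is K * sqrt(det M)
    * exp(-beta V(q)), again a constant times the same function. The section on marginals treats any
    Hamiltonian whose slice integrals are c * f(q): by Tonelli Z = c * int f, so c cancels and the
    position density is f / int f. Both Hamiltonians, and all values of nu, thus share one
    marginal. *)

Definition quad_form {R : realType} {n : nat} (S : 'M[R]_n) (v : 'cV[R]_n) : R :=
  (v^T *m S *m v) 0 0.

(** * Completing the square in the first coordinate *)

Section schur_complement.
Context {R : realType} {n : nat}.
Variable S : 'M[R]_(1 + n).
Hypothesis S_spd : symposdef S.

Let a : R := S 0 0.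
Let b : 'cV[R]_n := dlsubmx S.

Definition schur_complement : 'M[R]_n := drsubmx S - a^-1 *: (b *m b^T).

Let S_block : S = block_mx a%:M b^T b (drsubmx S).
Proof.
rewrite -[LHS]submxK; congr block_mx.
  rewrite [LHS]mx11_scalar; congr (_%:M); rewrite !mxE.
  by congr (S _ _); apply: val_inj.
by rewrite /b trmx_dlsub S_spd.1.
Qed.

Lemma spd_corner_gt0 : 0 < S 0 0.
Proof.
have := S_spd.2 (delta_mx 0 0); rewrite trmx_delta -rowE -colE !mxE; apply.
by apply/eqP => /matrixP /(_ 0 0); rewrite !mxE eqxx => /eqP; rewrite oner_eq0.
Qed.

(** One step of block elimination: the unipotent [L] clears the column below the corner without
    changing the determinant. *)
Lemma det_schur_complement : \det S = S 0 0 * \det schur_complement.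
Proof.
have a0 : a != 0 by rewrite gt_eqF// spd_corner_gt0.
pose L : 'M[R]_(1 + n) := block_mx 1%:M 0 (- a^-1 *: b) 1%:M.
have detL : \det L = 1 by rewrite det_lblock !det1 mulr1.
transitivity (\det (L *m S)); first by rewrite det_mulmx detL mul1r.
rewrite -[S 0 0]/a S_block mulmx_block !mul1mx !mul0mx !addr0 -scalemxAl mul_mx_scalar.
rewrite scalerA mulNr mulVf// scaleN1r addNr det_ublock det_scalar1.
by rewrite /schur_complement -scalemxAl scaleNr addrC.
Qed.

(** The double minus keeps the square in the form (x - m)^2 expected by [integral_gauss1], with m
    the minimizer in x for fixed v. *)
Lemma quad_form_schur x (v : 'cV[R]_n) :
  quad_form S (col_mx x%:M v) =
  S 0 0 * (x - - ((S 0 0)^-1 * (b^T *m v) 0 0)) ^+ 2 + quad_form schur_complement v.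
Proof.
have a0 : a != 0 by rewrite gt_eqF// spd_corner_gt0.
rewrite -[S 0 0]/a /quad_form S_block.
rewrite tr_col_mx mul_row_block mul_row_col tr_scalar_mx.
rewrite /schur_complement mulmxBr mulmxBl.
have bv : v^T *m b = ((b^T *m v) 0 0)%:M.
  rewrite -mx11_scalar -[v^T *m b]trmxK trmx_mul trmxK.
  by apply/matrixP => i j; rewrite mxE !ord1.
rewrite -scalemxAr -scalemxAl (mulmxA v^T b) bv !mulmxDl -!mulmxA.
rewrite (mx11_scalar (b^T *m v)); set t := (b^T *m v) 0 0.
rewrite !mul_scalar_mx. rewrite !scale_scalar_mx.
rewrite !mxE /= !mulr1n. set D := \sum_ _ _.
by field.
Qed.

(** Taking x to be the minimizer kills the square, so the complement at v is the value of S at a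
    nonzero vector. *)
Lemma spd_schur_complement : symposdef schur_complement.
Proof.
split.
  by rewrite /schur_complement linearB linearZ /= trmx_mul trmxK trmx_drsub S_spd.1.
move=> v v0; have := S_spd.2 (col_mx (- ((S 0 0)^-1 * (b^T *m v) 0 0))%:M v).
rewrite -/(quad_form _ _) quad_form_schur subrr expr0n mulr0 add0r; apply.
by rewrite col_mx_eq0 negb_and v0 orbT.
Qed.

End schur_complement.

(** * Measurability of matrix expressions *)

Section measurable_matrix.
Context d (T : measurableType d) {R : realType}.

Lemma measurable_quad_form n (A : T -> 'M[R]_n) (v : T -> 'cV[R]_n) :
  (forall i j, measurable_fun setT (fun x => A x i j)) ->
  (forall i, measurable_fun setT (fun x => v x i 0)) ->
  measurable_fun setT (fun x => quad_form (A x) (v x)).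
Proof.
move=> mA mv; rewrite /quad_form.
under eq_fun do rewrite mxE; apply: measurable_sum => i.
apply: measurable_funM => //; under eq_fun do rewrite mxE.
apply: measurable_sum => j; apply: measurable_funM => //.
by under eq_fun do rewrite mxE; exact: mv.
Qed.

Lemma measurable_det n (A : T -> 'M[R]_n) :
  (forall i j, measurable_fun setT (fun x => A x i j)) ->
  measurable_fun setT (fun x => \det (A x)).
Proof.
move=> mA; rewrite /determinant; apply: measurable_sum => s.
by apply: measurable_funM => //; exact: measurable_prod.
Qed.

Lemma measurable_invmx n (A : T -> 'M[R]_n) :
  (forall i j, measurable_fun setT (fun x => A x i j)) ->
  (forall x, 0 < \det (A x)) ->
  forall i j, measurable_fun setT (fun x => invmx (A x) i j).
Proof.
move=> mA A0 i j.
(* Cramer's rule, with 1/det written as exp(-ln det), a composition of measurable functions that is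
   valid because det is positive. *)
rewrite (_ : (fun _ => _) = fun x => expR (- ln (\det (A x))) * \adj (A x) i j).
  apply: measurable_funM.
    apply: measurableT_comp => //; apply: measurableT_comp => //.
    by apply: measurableT_comp => //; exact: measurable_det.
  under eq_fun do rewrite mxE. apply: measurable_funM => //.
  apply: measurable_det => k l. under eq_fun do rewrite !mxE. exact: mA.
apply/funext => x; rewrite /invmx unitmxE unitfE gt_eqF// mxE.
by rewrite expRN lnK// posrE.
Qed.

End measurable_matrix.

(** * Open sets of R^n lie in the product sigma-algebra *)

Section measurable_continuous.
Context {R : realType} {n : nat}.

Lemma measurable_ball_cV (c : 'cV[R]_n) (e : R) : measurable (ball c e).
Proof.
(* A ball of nonpositive radius is empty, whereas for n = 0 the intersection of coordinate
   conditions below is the whole space. *)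
have [e0|e0] := leP e 0.
  suff -> : ball c e = set0 by [].
  by apply/seteqP; split => // x [] /lt_geF; rewrite e0.
suff -> : ball c e = \bigcap_(i in [set: 'I_n])
    ((fun v : 'cV[R]_n => v i 0 : measurableTypeR R) @^-1` ball (c i 0) e).
  apply: fin_bigcap_measurable => // i _.
  rewrite -[X in measurable X]setTI; apply: measurable_coord => //.
  exact: measurable_ball.
apply/seteqP; split => [x [_ cx] i _|x cx]; first exact: cx.
by split => // i j; rewrite ord1; exact: cx.
Qed.

(** Second countability: U is the union of the countably many balls with rational centre and radius
    that it contains. *)
Lemma measurable_open_cV (U : set 'cV[R]_n) : open U -> measurable U.
Proof.
move=> oU.
pose B (i : 'cV[rat]_n * rat) : set 'cV[R]_n := ball (map_mx (@ratr R) i.1) (ratr i.2 : R).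
suff -> : U = \bigcup_i (if `[< B i `<=` U >] then B i else set0).
  apply: countable_bigcupT_measurable => // i.
  by case: ifP => // _; exact: measurable_ball_cV.
apply/seteqP; split => [x Ux|x [i _]]; last by case: asboolP => // + Bx; exact.
have /nbhs_ballP[e /= e0 xeU] : nbhs x U by exact: open_nbhs_nbhs.
(* With r < e/2 and a rational centre within r of x, the ball of radius r about that centre stays
   inside the e-ball about x. *)
have [r /itvP r_e2] := rat_in_itvoo (divr_gt0 e0 (ltr0n R 2)).
have r0 : 0 < ratr r :> R by rewrite r_e2.
have /choice[c xc] (i : 'I_n) : exists q : rat, ball (x i 0) (ratr r : R) (ratr q).
  have : x i 0 - ratr r < x i 0 + ratr r by rewrite ltrD2l gt0_cp.
  by move=> /rat_in_itvoo[q qx]; exists q; rewrite ball_itv.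
pose C : 'cV[rat]_n := \col_i c i.
have xC : ball x (ratr r) (map_mx (@ratr R) C : 'cV[R]_n).
  by split => // i j; rewrite ord1 !mxE; exact: xc.
exists (C, r) => //; case: asboolP => [_|]; first exact: ball_sym.
case; move=> y Cy; apply: xeU; apply: (@le_ball _ _ x (ratr r + ratr r)).
  by rewrite [leRHS](splitr e) lerD// ltW// r_e2.
exact: ball_triangle xC Cy.
Qed.

Lemma continuous_measurable_cV (f : 'cV[R]_n -> R) :
  continuous f -> measurable_fun setT f.
Proof.
move=> cf; apply: (measurability _ (RGenOpens.measurableE R)).
move=> _ [_ [a [b ->]] <-]; rewrite setTI; apply: measurable_open_cV.
by move/continuousP : cf; apply; exact: interval_open.
Qed.

End measurable_continuous.

(** * Gaussian integrals *)

Section gaussian_integral.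
Context {R : realType}.

Lemma integral_gauss1 (c m : R) : 0 < c ->
  (\int[@lebesgue_measure R]_x (expR (- (c * (x - m) ^+ 2)))%:E =
   (Num.sqrt (pi / c))%:E)%E.
Proof.
(* The integrand is a multiple of the normal density of mean m and variance 1/(2c), whose total mass
   is 1. *)
move=> c0; pose s : R := Num.sqrt (2 * c)^-1.
have s2 : s ^+ 2 = (2 * c)^-1 by rewrite sqr_sqrtr// invr_ge0 mulr_ge0// ltW.
have s0 : s != 0 by rewrite -sqrf_eq0 s2 invr_eq0 mulf_neq0// gt_eqF.
have pk0 := normal_peak_gt0 s0.
have gaussE x : expR (- (c * (x - m) ^+ 2)) = (normal_peak s)^-1 * normal_pdf m s x.
  rewrite normal_pdfE// mulKf ?gt_eqF// /normal_fun s2; congr expR.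
  by field; rewrite gt_eqF.
under eq_integral do rewrite gaussE EFinM.
rewrite ge0_integralZl//.
- rewrite integral_normal_pdf mule1 /normal_peak invrK s2; congr (Num.sqrt _)%:E.
  by field; rewrite gt_eqF.
- by apply/measurable_EFinP; exact: measurable_normal_pdf.
- by move=> x _; rewrite lee_fin normal_pdf_ge0.
- by rewrite lee_fin invr_ge0 ltW.
Qed.

Lemma measurable_gaussian n (beta : R) (S : 'M[R]_n) :
  measurable_fun setT
    (fun v : 'cV[R]_n => (expR (- (beta * (2^-1 * quad_form S v))))%:E).
Proof.
apply/measurable_EFinP; apply: measurableT_comp => //; apply: measurableT_comp => //.
apply: measurable_funM => //; apply: measurable_funM => //.
by apply: measurable_quad_form => // i; exact: measurable_coord.
Qed.

(** Positivity of the determinant is carried along because it obeys the same recursion through the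
    Schur complement; [symposdef_det_gt0] extracts it. *)
Lemma integral_gaussian (beta : R) n (S : 'M[R]_n) : 0 < beta -> symposdef S ->
  0 < \det S /\
  (\int[lebesgue_cV R n]_v (expR (- (beta * (2^-1 * quad_form S v))))%:E =
   (Num.sqrt (pi * 2 / beta) ^+ n * (Num.sqrt (\det S))^-1)%:E)%E.
Proof.
move=> beta0; elim: n S => [|n IH] S S_spd.
  rewrite det_mx00 ltr01; split => //=.
  rewrite integral_dirac//; last exact: measurable_gaussian.
  by rewrite diracT mul1e /quad_form !mxE big_ord0 !mulr0 oppr0 expR0 sqrtr1 invr1 mulr1 expr0.
have a0 := @spd_corner_gt0 R n S S_spd.
have [dS IHS] := IH _ (@spd_schur_complement R n S S_spd).
have detE : \det S = _ := @det_schur_complement R n S S_spd.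
split; first by rewrite detE mulr_gt0.
rewrite /= (ge0_integral_pushforward (@measurable_consv R n))//; last exact: measurable_gaussian.
have mg : measurable_fun setT ((fun v : 'cV[R]_n.+1 =>
    (expR (- (beta * (2^-1 * quad_form S v))))%:E) \o @consv R n).
  by apply: measurableT_comp; [exact: measurable_gaussian|exact: measurable_consv].
rewrite preimage_setT (fubini_tonelli2 _ mg); last first.
  by move=> x; rewrite lee_fin expR_ge0.
rewrite /fubini_G /=.
set c := beta * (2^-1 * S 0 0).
have c0 : 0 < c by rewrite !mulr_gt0// invr_gt0.
(* For fixed v the first coordinate contributes a shifted one-dimensional Gaussian; its integral
   does not see the shift, so only the form of the complement still depends on v. *)
have slice v : (\int[@lebesgue_measure R]_x
      (expR (- (beta * (2^-1 * quad_form S (consv (x, v))))))%:E =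
    (Num.sqrt (pi / c))%:E *
      (expR (- (beta * (2^-1 * quad_form (schur_complement S) v))))%:E)%E.
  set m := - ((S 0 0)^-1 * ((dlsubmx (S : 'M[R]_(1 + n)))^T *m v) 0 0).
  rewrite [RHS]muleC -(integral_gauss1 m c0) -ge0_integralZl//.
  - apply: eq_integral => x _; rewrite -EFinM -expRD; congr (expR _)%:E.
    by rewrite /consv/= (@quad_form_schur R n S S_spd) -/m /c; ring.
  - apply/measurable_EFinP; apply: measurableT_comp => //; apply: measurableT_comp => //.
    by apply: measurable_funM => //; apply: measurable_funX; exact: measurable_funB.
under eq_integral do rewrite slice.
rewrite ge0_integralZl//; last exact: measurable_gaussian.
rewrite IHS -EFinM; congr (_%:E).
rewrite exprSr detE [Num.sqrt (S 0 0 * _)]sqrtrM ?ltW//.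
have -> : pi / c = (pi * 2 / beta) / S 0 0 by rewrite /c; field; rewrite !gt_eqF.
rewrite sqrtrM ?divr_ge0 ?mulr_ge0 ?pi_ge0 ?ltW// sqrtrV ?ltW//.
by rewrite invfM; ring.
Qed.

End gaussian_integral.

(** * Positive definiteness of inverses and of the penalized mass *)

Section symposdef_theory.
Context {R : realType}.

Lemma symposdef_det_gt0 n (S : 'M[R]_n) : symposdef S -> 0 < \det S.
Proof. by case/(integral_gaussian ltr01). Qed.

Lemma symposdef_unitmx n (S : 'M[R]_n) : symposdef S -> S \in unitmx.
Proof. by move=> /symposdef_det_gt0 dS; rewrite unitmxE unitfE gt_eqF. Qed.

Lemma symposdef_invmx n (S : 'M[R]_n) : symposdef S -> symposdef (invmx S).
Proof.
move=> S_spd; have uS := symposdef_unitmx S_spd; have [tS S0] := S_spd.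
split; first by rewrite trmx_inv tS.
move=> x x0; set y := invmx S *m x; have xE : x = S *m y by rewrite mulKVmx.
rewrite xE trmx_mul tS -!mulmxA mulKVmx// mulmxA; apply: S0.
by apply: contra_neq x0 => y0; rewrite xE y0 mulmx0.
Qed.

Lemma symposdef_penalized_mass d n (M : 'M[R]_d) (Mz : 'M[R]_n)
    (xi : 'cV[R]_d -> 'cV[R]_n) (nu : R) q :
  symposdef M -> symposdef Mz -> symposdef (penalized_mass M Mz xi nu q).
Proof.
move=> [tM M0] [tMz Mz0]; rewrite /penalized_mass; set G := grad xi q.
split; first by rewrite linearD linearZ/= !trmx_mul trmxK tM tMz mulmxA.
move=> x x0; rewrite mulmxDr mulmxDl mxE ltr_pwDl ?M0//.
rewrite -scalemxAr -scalemxAl mxE mulr_ge0 ?sqr_ge0//.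
(* The penalty is the form of [Mz] pulled back along the transposed gradient: nonnegative, and
   possibly zero, so strictness comes from [M]. *)
have -> : x^T *m (G *m Mz *m G^T) *m x = (G^T *m x)^T *m Mz *m (G^T *m x).
  by rewrite trmx_mul trmxK !mulmxA.
have [->|Gx0] := eqVneq (G^T *m x) 0; first by rewrite mulmx0 mxE.
by rewrite ltW// Mz0.
Qed.

End symposdef_theory.

Lemma integral_lebesgue_cV_gt0 (R : realType) n (f : 'cV[R]_n -> R) :
  measurable_fun setT f -> (forall x, 0 < f x) ->
  (0 < \int[lebesgue_cV R n]_x (f x)%:E)%E.
Proof.
move=> mf f0; rewrite lt0e integral_ge0 ?andbT; last first.
  by move=> x _; rewrite lee_fin ltW.
(* Otherwise f > 0 vanishes a.e., so the whole space is negligible, and even *)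
(* the Gaussian would have integral zero.                                    *)
apply/eqP => intf0.
have S_spd : symposdef (1%:M : 'M[R]_n).
  split; first exact: tr_scalar_mx.
  move=> x x0; rewrite mulmx1 mxE; under eq_bigr do rewrite mxE -expr2.
  rewrite lt_neqAle sumr_ge0 ?andbT; last by move=> i _; exact: sqr_ge0.
  rewrite eq_sym psumr_neq0; last by move=> i _; exact: sqr_ge0.
  have /cV0Pn[i xi0] := x0.
  by apply/hasP; exists i; rewrite ?mem_index_enum//= exprn_even_gt0.
have [_ intg] := integral_gaussian ltr01 S_spd.
have mg := @measurable_gaussian R n 1 1%:M.
suff : (\int[lebesgue_cV R n]_v `|(expR (- (1 * (2^-1 * quad_form 1%:M v))))%:E| = 0)%E.
  under eq_integral do rewrite gee0_abs ?lee_fin ?expR_ge0//.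
  have s0 : 0 < Num.sqrt (pi * 2 / 1) :> R by rewrite sqrtr_gt0 divr_gt0 ?mulr_gt0 ?pi_gt0.
  by rewrite intg => -[] /eqP; rewrite gt_eqF// det1 divr_gt0 ?exprn_gt0// sqrtr_gt0.
apply/(ae_eq_integral_abs _ measurableT mg).
have : (\int[lebesgue_cV R n]_v `|(f v)%:E| = 0)%E.
  by under eq_integral do rewrite gee0_abs ?lee_fin ?ltW//.
move/(ae_eq_integral_abs _ measurableT) => /(_ _)/wrap[].
  exact/measurable_EFinP.
by apply: filterS => x /(_ I) /= [] /eqP; rewrite gt_eqF.
Qed.

(** * Momentum integrals at fixed position *)

Section boltzmann_slices.
Context {R : realType} {d : nat}.
Variables (beta : R) (A : 'cV[R]_d -> 'M[R]_d) (U : 'cV[R]_d -> R).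
Hypothesis A_spd : forall q, symposdef (A q).

(** This covers both cases: A = M_nu with U = V + V_fix,nu, and constant A = M with U = V. *)
Let H p q := kinetic (A q) p + U q.

Let boltzmannE p q : boltzmann beta H (p, q) =
  ((expR (- beta * U q))%:E *
   (expR (- (beta * (2^-1 * quad_form (invmx (A q)) p))))%:E)%E.
Proof.
rewrite /boltzmann /= -EFinM -expRD; congr (expR _)%:E.
by rewrite /H /kinetic -/(quad_form _ _); ring.
Qed.

Lemma integral_boltzmann_slice q : 0 < beta ->
  (\int[lebesgue_cV R d]_p boltzmann beta H (p, q) =
   (Num.sqrt (pi * 2 / beta) ^+ d * Num.sqrt (\det (A q)) *
    expR (- beta * U q))%:E)%E.
Proof.
move=> beta0; under eq_integral do rewrite boltzmannE.
rewrite ge0_integralZl//.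
- rewrite (integral_gaussian beta0 (symposdef_invmx (A_spd q))).2 det_inv -EFinM.
  by rewrite sqrtrV ?ltW ?symposdef_det_gt0// invrK mulrC.
- exact: measurable_gaussian.
Qed.

Lemma measurable_boltzmann :
  (forall i j, measurable_fun setT (fun q => A q i j)) ->
  measurable_fun setT U -> measurable_fun setT (boltzmann beta H).
Proof.
move=> mA mU; apply/measurable_EFinP; apply: measurableT_comp => //.
apply: measurable_funM => //; apply: measurable_funD; last first.
  by apply: measurableT_comp => //; exact: measurable_snd.
apply: measurable_funM => //; apply: measurable_quad_form => [i j|i].
  apply: (measurableT_comp (f := fun q => invmx (A q) i j)); last exact: measurable_snd.
  by apply: measurable_invmx => // q; exact: symposdef_det_gt0.
apply: (measurableT_comp (f := fun p : 'cV[R]_d => p i 0)); last exact: measurable_fst.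
exact: measurable_coord.
Qed.

End boltzmann_slices.

(** * Normalization and position marginal from the slice integrals *)

Section marginal.
Context {R : realType} {d : nat}.
Variables (beta c : R) (H : 'cV[R]_d -> 'cV[R]_d -> R) (f : 'cV[R]_d -> R).
Hypothesis c_gt0 : 0 < c.
Hypothesis f_gt0 : forall q, 0 < f q.
Hypothesis f_int : (lebesgue_cV R d).-integrable setT (fun q => (f q)%:E).
Hypothesis mH : measurable_fun setT (boltzmann beta H).
Hypothesis sliceH : forall q,
  (\int[lebesgue_cV R d]_p boltzmann beta H (p, q) = (c * f q)%:E)%E.
Local Open Scope ereal_scope.

Let Zf : \bar R := \int[lebesgue_cV R d]_q (f q)%:E.

Let mf : measurable_fun setT f.
Proof. by apply/measurable_EFinP; exact: measurable_int f_int. Qed.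

Let f_ge0 q : 0 <= (f q)%:E. Proof. by rewrite lee_fin ltW. Qed.

Let Zf_fin : Zf \is a fin_num. Proof. exact: integrable_fin_num. Qed.

Let Zf_gt0 : 0 < Zf. Proof. exact: integral_lebesgue_cV_gt0. Qed.

Let boltzmann_ge0 x : 0 <= boltzmann beta H x.
Proof. by rewrite lee_fin expR_ge0. Qed.

Lemma partition_functionE : partition_function beta H = c%:E * Zf.
Proof.
rewrite /partition_function /phase_volume (fubini_tonelli2 _ mH boltzmann_ge0).
rewrite /fubini_G; under eq_integral do rewrite sliceH EFinM.
rewrite ge0_integralZl//; first exact/measurable_EFinP.
by rewrite lee_fin ltW.
Qed.

Lemma partition_function_gt0 : 0 < partition_function beta H.
Proof. by rewrite partition_functionE mule_gt0. Qed.

Lemma integrable_boltzmann : phase_volume.-integrable setT (boltzmann beta H).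
Proof.
apply/integrableP; split => //.
under eq_integral do rewrite gee0_abs//.
rewrite -/(partition_function beta H) partition_functionE.
by rewrite ltey_eq fin_numM.
Qed.

Let Zinv_ge0 : 0 <= (partition_function beta H)^-1.
Proof. by rewrite inve_ge0 ltW// partition_function_gt0. Qed.

Lemma position_marginalE (B : set 'cV[R]_d) : measurable B ->
  position_marginal beta H B =
  \int[lebesgue_cV R d]_(q in B) ((partition_function beta H)^-1 *
    \int[lebesgue_cV R d]_p boltzmann beta H (p, q)).
Proof.
move=> mB; rewrite /position_marginal /pushforward /canonical_distribution.
set g := fun x => _ * boltzmann beta H x.
have mg : measurable_fun setT g by exact: measurable_funeM.
have mS : measurable (snd @^-1` B : set ('cV[R]_d * 'cV[R]_d)).
  by rewrite -[X in measurable X]setTI; exact: measurable_snd.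
have mgS : measurable_fun setT (g \_ (snd @^-1` B)).
  by apply/(measurable_restrictT _ _).1 => //; exact: measurable_funTS.
have gS_ge0 x : 0 <= (g \_ (snd @^-1` B)) x.
  by apply: erestrict_ge0 => y _; exact: mule_ge0.
(* The indicator of the cylinder over [B] depends on q alone, so after Tonelli each momentum slice
   is either complete or zero. *)
rewrite integral_mkcond [RHS]integral_mkcond (fubini_tonelli2 _ mgS gS_ge0).
apply: eq_integral => q _; rewrite /fubini_G patchE; case: ifPn => qB.
  rewrite -ge0_integralZl//; last exact: measurableT_comp.
  by apply: eq_integral => p _; rewrite patchE ifT// mem_set//=; rewrite inE in qB.
apply: integral0_eq => p _; rewrite patchE ifF//.
by apply: contraNF qB; rewrite !inE.
Qed.

Lemma marginal_density q :
  (partition_function beta H)^-1 * \int[lebesgue_cV R d]_p boltzmann beta H (p, q) =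
  (f q)%:E / Zf.
Proof.
rewrite sliceH partition_functionE.
(* Inversion in the extended reals agrees with the real one only at nonzero finite values, so [Zf]
   is first reduced to a positive real; then c cancels. *)
move: Zf_gt0 Zf_fin; case: Zf => // r; rewrite lte_fin => r0 _.
rewrite -EFinM !inver !gt_eqF ?mulr_gt0// -!EFinM; congr (_%:E).
by field; rewrite !gt_eqF.
Qed.

Lemma position_marginal_density (B : set 'cV[R]_d) : measurable B ->
  position_marginal beta H B = \int[lebesgue_cV R d]_(q in B) ((f q)%:E / Zf).
Proof.
by move=> mB; rewrite position_marginalE//; apply: eq_integral => q _; exact: marginal_density.
Qed.

Lemma canonical_distribution_setT : canonical_distribution beta H setT = 1.
Proof.
have -> : canonical_distribution beta H setT = position_marginal beta H setT by [].
rewrite position_marginal_density//; under eq_integral do rewrite muleC.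
rewrite ge0_integralZl//; last 2 first.
- exact/measurable_EFinP.
- by rewrite inve_ge0 ltW.
rewrite -/Zf; move: Zf_gt0 Zf_fin; case: Zf => // r; rewrite lte_fin => r0 _.
by rewrite inver gt_eqF// -EFinM mulVf ?gt_eqF.
Qed.

End marginal.

(** * Measurability of the penalized mass and the factor produced by V_fix *)

Section penalized_mass_theory.
Context {R : realType} {d n : nat}.
Variables (M : 'M[R]_d) (Mz : 'M[R]_n) (xi : 'cV[R]_d -> 'cV[R]_n).

Lemma measurable_grad : smooth xi ->
  forall j i, measurable_fun setT (fun q => grad xi q j i).
Proof.
move=> xi_smooth j i; under eq_fun do rewrite mxE.
apply: continuous_measurable_cV.
by have [_ /(_ j)[_ []]] := xi_smooth i 1%N.
Qed.

Lemma measurable_penalized_mass nu : smooth xi ->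
  forall i j, measurable_fun setT (fun q => penalized_mass M Mz xi nu q i j).
Proof.
move=> xi_smooth i j; have mG := measurable_grad xi_smooth.
rewrite /penalized_mass; under eq_fun do rewrite !mxE.
apply: measurable_funD => //; apply: measurable_funM => //.
apply: measurable_sum => k; apply: measurable_funM; last first.
  by under eq_fun do rewrite mxE; exact: mG.
under eq_fun do rewrite mxE.
by apply: measurable_sum => l; apply: measurable_funM.
Qed.

Lemma expR_Vfix (beta nu : R) q :
  0 < beta -> symposdef M -> symposdef Mz ->
  expR (- beta * Vfix M Mz xi beta nu q) =
  (Num.sqrt (\det (penalized_mass M Mz xi nu q)))^-1.
Proof.
move=> beta0 M_spd Mz_spd; rewrite /Vfix; set D := \det _.
have D0 : 0 < D by exact/symposdef_det_gt0/symposdef_penalized_mass.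
have sD0 : 0 < Num.sqrt D by rewrite sqrtr_gt0.
(* The factor 1/(2 beta) in V_fix is what makes the exponent equal to -ln(sqrt D). *)
have -> : ln D = 2 * ln (Num.sqrt D).
  by rewrite -{1}(sqr_sqrtr (ltW D0)) lnXn// mulr_natl.
have -> : - beta * ((2 * beta)^-1 * (2 * ln (Num.sqrt D))) = - ln (Num.sqrt D).
  by field; rewrite gt_eqF.
by rewrite expRN lnK// posrE.
Qed.

End penalized_mass_theory.

Unset Implicit Arguments.
Local Open Scope ereal_scope.

Theorem proposition3p5 (R : realType) (d n : nat)
    (M : 'M[R]_d) (Mz : 'M[R]_n) (beta nu : R)
    (V : 'cV[R]_d -> R) (xi : 'cV[R]_d -> 'cV[R]_n)
    (M_spd : symposdef M) (Mz_spd : symposdef Mz)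
    (beta_gt0 : (0 < beta)%R) (nu_ge0 : (0 <= nu)%R)
    (xi_smooth : smooth xi)
    (V_int : (lebesgue_cV R d).-integrable setT
               (fun q => (expR (- beta * V q))%:E)) :
  let H := hamiltonian M V in
  let Hnu := penalized_hamiltonian M Mz xi V beta in
  let Znu k := partition_function beta (Hnu k) in
  [/\ [/\ phase_volume.-integrable setT (boltzmann beta (Hnu nu)),
          0 < Znu nu
        & canonical_distribution beta (Hnu nu) setT = 1],
      (forall A : set 'cV[R]_d, measurable A ->
        position_marginal beta (Hnu nu) A =
        \int[lebesgue_cV R d]_(q in A)
          ((Znu nu)^-1 * \int[lebesgue_cV R d]_p boltzmann beta (Hnu nu) (p, q))),
      (forall q : 'cV[R]_d,
        (Znu nu)^-1 * \int[lebesgue_cV R d]_p boltzmann beta (Hnu nu) (p, q) =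
        (expR (- beta * V q))%:E /
          \int[lebesgue_cV R d]_q' (expR (- beta * V q'))%:E),
      (forall A : set 'cV[R]_d, measurable A ->
        position_marginal beta (Hnu nu) A = position_marginal beta H A)
    & (forall nu' : R, (0 <= nu')%R ->
        forall A : set 'cV[R]_d, measurable A ->
          position_marginal beta (Hnu nu) A = position_marginal beta (Hnu nu') A)].
Proof.
move=> H Hnu Znu; set f := fun q => expR (- beta * V q).
have f0 q : (0 < f q)%R by rewrite expR_gt0.
(* Integrability of exp(-beta V) includes its measurability, and V is recovered from it by a
   logarithm. *)
have mV : measurable_fun setT V.
  rewrite (_ : V = fun q => (- beta^-1 * ln (f q))%R).
    apply: measurable_funM => //; apply: measurableT_comp => //.
    by apply/measurable_EFinP; exact: measurable_int V_int.
  by apply/funext => q; rewrite /f expRK; field; rewrite gt_eqF.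
set K := (Num.sqrt (pi * 2 / beta) ^+ d)%R.
have K0 : (0 < K)%R.
  by rewrite exprn_gt0// sqrtr_gt0 divr_gt0// mulr_gt0// pi_gt0.
have HnuE k : Hnu k = fun p q =>
    (kinetic (penalized_mass M Mz xi k q) p + (V q + Vfix M Mz xi beta k q))%R.
  by apply/funext => p; apply/funext => q; rewrite addrA.
have A_spd k q := symposdef_penalized_mass xi k q M_spd Mz_spd.
have mA k := measurable_penalized_mass M Mz k xi_smooth.
have mHnu k : measurable_fun setT (boltzmann beta (Hnu k)).
  rewrite HnuE; apply: measurable_boltzmann => //; apply: measurable_funD => //.
  apply: measurable_funM => //; apply: measurableT_comp => //.
  exact: measurable_det.
(* Here sqrt(det M_nu(q)) from the Gaussian integral cancels against its inverse from V_fix. *)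
have sliceHnu k q :
    \int[lebesgue_cV R d]_p boltzmann beta (Hnu k) (p, q) = (K * f q)%:E.
  rewrite HnuE integral_boltzmann_slice// [(- beta * (_ + _))%R]mulrDr expRD expR_Vfix//.
  congr (_%:E); rewrite -/K -/(f q); field.
  by rewrite gt_eqF// sqrtr_gt0 symposdef_det_gt0.
have mH : measurable_fun setT (boltzmann beta H).
  exact: (@measurable_boltzmann R d beta (fun=> M) V (fun=> M_spd)).
(* Nothing cancels here, but sqrt(det M) is constant in q and joins the constant c. *)
have sliceH q : \int[lebesgue_cV R d]_p boltzmann beta H (p, q) =
    (K * Num.sqrt (\det M) * f q)%:E.
  exact: (@integral_boltzmann_slice R d beta (fun=> M) V (fun=> M_spd)).
have KM0 : (0 < K * Num.sqrt (\det M))%R.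
  by rewrite mulr_gt0// sqrtr_gt0 symposdef_det_gt0.
(* The density obtained does not mention [k], which yields both the agreement with the original
   marginal and the independence of nu. *)
have marginalHnu k := position_marginal_density K0 f0 V_int (mHnu k) (sliceHnu k).
split.
- split; first exact: (integrable_boltzmann K0 f0 V_int (mHnu nu) (sliceHnu nu)).
  + exact: (partition_function_gt0 K0 f0 V_int (mHnu nu) (sliceHnu nu)).
  + exact: (canonical_distribution_setT K0 f0 V_int (mHnu nu) (sliceHnu nu)).
- exact: (position_marginalE K0 f0 V_int (mHnu nu) (sliceHnu nu)).
- exact: (marginal_density K0 f0 V_int (mHnu nu) (sliceHnu nu)).
- move=> A mA'; rewrite marginalHnu//.
  by rewrite (position_marginal_density KM0 f0 V_int mH sliceH).
- by move=> nu' _ A mA'; rewrite !marginalHnu.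
Qed.
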